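(* The self-dual antinorms on $\mathbb{R}^2_+$ are precisely the functions $f:\mathbb{R}^2_+\to[0,+\infty)$ obtained by the following construction. 1) Take an arbitrary $\boldsymbol{a}\in\mathbb{R}^2_+$ with $|\boldsymbol{a}|=1$; the ray $\{t\boldsymbol{a} : t\ge0\}$ splits $\mathbb{R}^2_+$ into two closed angles $K_1$ and $K_2$ (labelled in either order; one of them may degenerate to the ray itself). 2) Choose an arbitrary antinorm $f_1$ on $K_1$ such that $f_1(\boldsymbol{a})=1$ and $f_1(\boldsymbol{x})\le(\boldsymbol{a},\boldsymbol{x})$ for all $\boldsymbol{x}\in K_1$. 3) Define $f_2$ on $K_2$ by $$f_2(\boldsymbol{x}_2)=\inf_{\boldsymbol{x}_1\in K_1,\ f_1(\boldsymbol{x}_1)\ne0}\frac{(\boldsymbol{x}_1,\boldsymbol{x}_2)}{f_1(\boldsymbol{x}_1)},\qquad \boldsymbol{x}_2\in K_2,$$ and set $f(\boldsymbol{x})=f_1(\boldsymbol{x})$ for $\boldsymbol{x}\in K_1$ and $f(\boldsymbol{x})=f_2(\boldsymbol{x})$ for $\boldsymbol{x}\in K_2$. That is, every function $f$ obtained in this way is a self-dual antinorm on $\mathbb{R}^2_+$, and every self-dual antinorm on $\mathbb{R}^2_+$ is obtained in this way.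
   Context: $\mathbb{R}^2_+$ is the closed positive quadrant, $(\cdot,\cdot)$ the standard inner product, $|\cdot|$ the Euclidean norm. An antinorm on a closed convex cone $K$ is a nonnegative, somewhere positive, concave, homogeneous functional $f:K\to[0,+\infty)$, where homogeneous means $f(\lambda\boldsymbol{x})=\lambda f(\boldsymbol{x})$ for all $\lambda\ge0$; the same definition is used when the angle $K$ degenerates to a ray. All antinorms are assumed to be continuous. The dual of an antinorm $f$ on $\mathbb{R}^2_+$ is $$f^*(\boldsymbol{p})=\inf_{\boldsymbol{x}\in\mathbb{R}^2_+,\ f(\boldsymbol{x})\ne0}\frac{(\boldsymbol{p},\boldsymbol{x})}{f(\boldsymbol{x})},\qquad \boldsymbol{p}\in\mathbb{R}^2_+,$$ and $f$ is called self-dual if $f^*=f$. *)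

(* Defs.v *)
From mathcomp Require Export all_boot all_order all_algebra.
From mathcomp Require Export all_classical all_reals all_analysis.

Set Implicit Arguments.
Unset Strict Implicit.
Unset Printing Implicit Defensive.

Import Order.TTheory GRing.Theory Num.Theory.
Import numFieldNormedType.Exports.

Local Open Scope classical_set_scope.
Local Open Scope ring_scope.

Definition dot (R : realType) (x y : 'rV[R]_2) : R := \sum_(i < 2) x 0 i * y 0 i.

(* The library norm `|x| on 'rV[R]_2 is the sup norm, hence this one. *)
Definition enorm (R : realType) (x : 'rV[R]_2) : R := Num.sqrt (dot x x).

Definition quadrant (R : realType) : set 'rV[R]_2 :=
  [set x | forall i, 0 <= x 0 i].
Arguments quadrant : clear implicits.

(* The closed angle with sides the rays of u and v; it is a ray when u = v.
   This is the convex angle, as needed for u and v in the quadrant. *)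
Definition angle (R : realType) (u v : 'rV[R]_2) : set 'rV[R]_2 :=
  [set x | exists s t : R, [/\ 0 <= s, 0 <= t & x = s *: u + t *: v]].

(* The ray of a splits the quadrant into subangle a 0 and subangle a 1, where
   subangle a i is bounded by the ray of a and the i-th coordinate half-axis. *)
Definition subangle (R : realType) (a : 'rV[R]_2) (i : 'I_2) : set 'rV[R]_2 :=
  angle (delta_mx 0 i) a.

(* A functional on K is represented by a total function of which only the
   values on K matter. *)
Record antinorm (R : realType) (K : set 'rV[R]_2) (f : 'rV[R]_2 -> R) : Prop :=
  Antinorm {
    antinorm_ge0 : forall x, K x -> 0 <= f x;
    antinorm_pos : exists2 x, K x & 0 < f x;
    antinorm_concave : convex_function K (fun x => - f x);
    antinorm_homogeneous :
      forall (l : R) x, 0 <= l -> K x -> f (l *: x) = l * f x;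
    antinorm_continuous : {within K, continuous f}
  }.

(* For p in the quadrant, K inside the quadrant and f an antinorm on K, the set
   is nonempty and bounded below by 0, so that the real-valued inf is the
   genuine infimum. *)
Definition dual_on (R : realType) (K : set 'rV[R]_2) (f : 'rV[R]_2 -> R)
    (p : 'rV[R]_2) : R :=
  inf [set dot p x / f x | x in [set x | K x /\ f x != 0]].

Definition dual (R : realType) (f : 'rV[R]_2 -> R) : 'rV[R]_2 -> R :=
  dual_on (quadrant R) f.

Definition self_dual (R : realType) (f : 'rV[R]_2 -> R) : Prop :=
  forall p, quadrant R p -> dual f p = f p.

(* i and j are the labels of the two angles: K_1 = subangle a i and
   K_2 = subangle a j. *)
Record construction_data (R : realType) (a : 'rV[R]_2) (i j : 'I_2)
    (f1 : 'rV[R]_2 -> R) : Prop := ConstructionData {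
  data_quadrant : quadrant R a;
  data_unit : enorm a = 1;
  data_labels : i != j;
  data_antinorm : antinorm (subangle a i) f1;
  data_normalized : f1 a = 1;
  data_le : forall x, subangle a i x -> f1 x <= dot a x
}.

Definition glued (R : realType) (a : 'rV[R]_2) (i j : 'I_2)
    (f1 f : 'rV[R]_2 -> R) : Prop :=
  (forall x, subangle a i x -> f x = f1 x) /\
  (forall x, subangle a j x -> f x = dual_on (subangle a i) f1 x).

(* Main.v *)
Require Import Defs.
From mathcomp Require Import all_boot all_order all_algebra.
From mathcomp Require Import all_classical all_reals all_analysis.
From mathcomp Require Import ring lra.

Import Order.TTheory GRing.Theory Num.Theory.
Import numFieldNormedType.Exports.
Local Open Scope classical_set_scope.
Local Open Scope ring_scope.

Set Implicit Arguments.
Unset Strict Implicit.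
Unset Printing Implicit Defensive.

(** Self-duality makes [f p * f x <= dot p x] hold throughout the quadrant,
    [f p] being the largest such factor. Applied to [x = p] it gives
    [f x <= |x|], and equality holds somewhere: if [a] is a unit vector at which
    [f] is maximal among unit vectors, with value [M], then [f <= M * dot a] by the first-order condition
    ([maximal_direction_support]), so that the dual at [a] is at least [M^-1]
    and [M = 1] ([self_dual_unit_point]). Hence [f a = 1] and [f <= dot a].

    Conversely suppose that [f] is prescribed on one of the two angles cut out
    by the ray of [a] and is defined by duality on the other. Both pieces lie
    below [dot a] and agree with it on the ray, so [dot a] supports [f] there
    and the pieces fit together into a concave function
    ([superadditive_across]). The inequality [f p * f x <= dot p x] across the
    ray is the definition of the second piece; for [p] and [x] on the same side
    it follows from [f p * f x <= dot a p * dot a x <= dot p x]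
    ([same_side_dot]). That the dual is not larger than [f] is built in on the
    second angle. On the first angle it is a bipolar argument: a functional that
    supports [f] at [p] is the inner product with some [q], and [f <= dot a]
    with equality at [a] forces [q] to lie on the other side of the ray, where
    [f q >= 1] by definition ([dual_glued_le_interior]). Continuity of the glued
    function is that of a dual ([dual_on_continuous]).

    Finally, gluing the restriction of a self-dual [f] produces a self-dual
    [g >= f], and since duality reverses order [f] and [g] coincide
    ([self_dual_constructed]). *)

(** * Plane vectors, cones and superlinear functionals *)

Section PlaneVectors.
Context {R : realType}.
Implicit Types x y z p a : 'rV[R]_2.

Definition det2 x y : R := x 0 0 * y 0 1 - x 0 1 * y 0 0.

Definition vec2 (u v : R) : 'rV[R]_2 := \row_k (if k == 0 then u else v).

Lemma ord2_case (i : 'I_2) : i = 0 \/ i = 1.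
Proof. by case: i => -[|[|k]] //= kP; [left|right]; apply/val_inj. Qed.

Lemma rowP2 x y : x 0 0 = y 0 0 -> x 0 1 = y 0 1 -> x = y.
Proof.
by move=> e0 e1; apply/rowP => k; case: (ord2_case k) => ->.
Qed.

Lemma dotE x y : dot x y = x 0 0 * y 0 0 + x 0 1 * y 0 1.
Proof.
rewrite /dot big_ord_recr big_ord_recr big_ord0 /= add0r.
by congr (x 0 _ * y 0 _ + x 0 _ * y 0 _); apply/val_inj.
Qed.

Lemma quadrantP x : quadrant R x <-> 0 <= x 0 0 /\ 0 <= x 0 1.
Proof.
split=> [Qx|[x0 x1] k]; first by split; apply: Qx.
by case: (ord2_case k) => ->.
Qed.

Lemma dotC x y : dot x y = dot y x.
Proof. by rewrite !dotE; ring. Qed.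

Lemma dotDl x y z : dot (x + y) z = dot x z + dot y z.
Proof. by rewrite !dotE !mxE; ring. Qed.

Lemma dotZl (l : R) x z : dot (l *: x) z = l * dot x z.
Proof. by rewrite !dotE !mxE; ring. Qed.

Lemma dotDr x y z : dot z (x + y) = dot z x + dot z y.
Proof. by rewrite !dotE !mxE; ring. Qed.

Lemma dotZr (l : R) x z : dot z (l *: x) = l * dot z x.
Proof. by rewrite !dotE !mxE; ring. Qed.

Lemma dot_quadrant_ge0 x y : quadrant R x -> quadrant R y -> 0 <= dot x y.
Proof.
by move=> /quadrantP[x0 x1] /quadrantP[y0 y1]; rewrite dotE addr_ge0 ?mulr_ge0.
Qed.

Lemma enorm1E x : (enorm x = 1) <-> (dot x x = 1).
Proof.
rewrite /enorm; split=> [e|->]; last by rewrite sqrtr1.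
have xx0 : 0 <= dot x x by rewrite dotE -!expr2 addr_ge0 ?sqr_ge0.
by rewrite -(sqr_sqrtr xx0) e expr1n.
Qed.

(** In the orthogonal frame of [p] and its rotate by a right angle, the two
    terms are the products of the matching coordinates. *)
Lemma dot_frame p x y :
  dot p p * dot x y = dot p x * dot p y + det2 p x * det2 p y.
Proof. by rewrite !dotE /det2; ring. Qed.

Lemma det2_eq0_colinear p x :
  dot p p != 0 -> det2 p x = 0 -> x = (dot p x / dot p p) *: p.
Proof.
move=> pp0 dpx; apply: rowP2; rewrite !mxE; apply: (mulIf pp0);
  rewrite [RHS]mulrAC (divfK pp0); apply/eqP; rewrite -subr_eq0; apply/eqP.
- by transitivity (- (p 0 1 * det2 p x)); [rewrite !dotE /det2; ring|
    rewrite dpx; ring].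
- by transitivity (p 0 0 * det2 p x); [rewrite !dotE /det2; ring|
    rewrite dpx; ring].
Qed.

(** The inclusion in the quadrant makes inner products nonnegative, and
    collinear vectors nonnegative multiples of one another. *)
Record convex_cone (K : set 'rV[R]_2) : Prop := ConvexCone {
  cone_quadrant : K `<=` quadrant R;
  coneD : forall x y, K x -> K y -> K (x + y);
  coneZ : forall (l : R) x, 0 <= l -> K x -> K (l *: x)
}.

Lemma quadrant_cone : convex_cone (quadrant R).
Proof.
split=> // [x y|l x l0] Qx; last by move=> i; rewrite mxE mulr_ge0 // Qx.
by move=> Qy i; rewrite mxE addr_ge0 // ?Qx ?Qy.
Qed.

Record superlinear (K : set 'rV[R]_2) (f : 'rV[R]_2 -> R) : Prop :=
  Superlinear {
    superlinear_ge0 : forall x, K x -> 0 <= f x;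
    superlinearD : forall x y, K x -> K y -> f x + f y <= f (x + y);
    superlinearZ : forall (l : R) x, 0 <= l -> K x -> f (l *: x) = l * f x
  }.

Lemma superlinear_sub (K L : set 'rV[R]_2) (f : 'rV[R]_2 -> R) :
  L `<=` K -> superlinear K f -> superlinear L f.
Proof.
by move=> LK [f0 fD fZ]; split=> [x /LK|x y /LK Kx /LK|l x l0 /LK];
  [exact: f0|exact: fD|exact: fZ].
Qed.

Lemma eq_superlinear (K : set 'rV[R]_2) (f g : 'rV[R]_2 -> R) :
  convex_cone K -> (forall x, K x -> f x = g x) ->
  superlinear K f -> superlinear K g.
Proof.
move=> coneK fg [f0 fD fZ]; split=> [x Kx|x y Kx Ky|l x l0 Kx].
- by rewrite -fg ?f0.
- by rewrite -!fg ?fD //; exact: coneD.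
- by rewrite -!fg ?fZ //; exact: coneZ.
Qed.

(** For homogeneous functionals concavity means superadditivity: a sum is
    twice a midpoint. *)
Lemma superlinear_antinorm (K : set 'rV[R]_2) (f : 'rV[R]_2 -> R) :
  convex_cone K -> antinorm K f -> superlinear K f.
Proof.
move=> coneK [f0 _ fconc fZ _]; split=> // x y Kx Ky.
have h0 : 0 <= 2^-1 :> R by rewrite invr_ge0.
have h1 : 2^-1 <= 1 :> R by rewrite invf_le1 // ler1n.
have := fconc (Itv01 h0 h1) x y; rewrite !inE => /(_ Kx Ky).
rewrite convRE /conv /= /unstable.onem.
rewrite (_ : 1 - 2^-1 = 2^-1 :> R); last by field.
rewrite -scalerDr fZ //; last exact: coneD.
by lra.
Qed.

Lemma antinorm_superlinear (K : set 'rV[R]_2) (f : 'rV[R]_2 -> R) :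
  convex_cone K -> superlinear K f -> (exists2 x, K x & 0 < f x) ->
  {within K, continuous f} -> antinorm K f.
Proof.
move=> coneK [f0 fD fZ] fpos fcont; split=> // t x y; rewrite !inE => Kx Ky.
rewrite convRE /conv /=.
have t0 : 0 <= t%:num by [].
have t1 : 0 <= unstable.onem t%:num :> R by rewrite /unstable.onem subr_ge0.
have Ktx := coneZ coneK t0 Kx; have Kty := coneZ coneK t1 Ky.
have := fD _ _ Ktx Kty; rewrite (fZ _ _ t0 Kx) (fZ _ _ t1 Ky); lra.
Qed.

End PlaneVectors.

(** * Duals *)

Section Duals.
Context {R : realType}.
Variables (K : set 'rV[R]_2) (f : 'rV[R]_2 -> R).
Hypotheses (coneK : convex_cone K) (supf : superlinear K f).
Hypothesis fpos : exists2 x, K x & 0 < f x.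
Implicit Types x y p : 'rV[R]_2.

(** Together with [dual_on_ge] this describes the dual at [p] as the largest
    [c] such that [c * f x <= dot p x] on [K]. The description avoids the
    division by [f], hence the case distinction on the zeros of [f]. *)
Lemma dual_on_mul_le p x :
  quadrant R p -> K x -> dual_on K f p * f x <= dot p x.
Proof.
move=> Qp Kx; have Qx := cone_quadrant coneK Kx.
have fx0 := superlinear_ge0 supf Kx.
have [->|fx] := eqVneq (f x) 0; first by rewrite mulr0 dot_quadrant_ge0.
have fx_gt0 : 0 < f x by rewrite lt_def fx.
rewrite -ler_pdivlMr //; apply: ge_inf; last by exists x.
exists 0 => _ [y [Ky _] <-].
apply: divr_ge0; last exact: (superlinear_ge0 supf).
by apply: dot_quadrant_ge0 => //; exact: (cone_quadrant coneK).
Qed.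

Lemma dual_on_ge p (c : R) :
  (forall x, K x -> c * f x <= dot p x) -> c <= dual_on K f p.
Proof.
move=> cle; apply: lb_le_inf.
  have [x Kx fx0] := fpos; exists (dot p x / f x), x => //.
  by split=> //; rewrite gt_eqF.
move=> _ [x [Kx fx] <-]; rewrite ler_pdivlMr ?cle //.
by rewrite lt_def fx (superlinear_ge0 supf).
Qed.

Lemma dual_on_superlinear : superlinear (quadrant R) (dual_on K f).
Proof.
have ge0 p : quadrant R p -> 0 <= dual_on K f p.
  move=> Qp; apply: dual_on_ge => x Kx; rewrite mul0r.
  by apply: dot_quadrant_ge0 => //; exact: (cone_quadrant coneK).
have geZ (l : R) p : 0 <= l -> quadrant R p ->
    l * dual_on K f p <= dual_on K f (l *: p).
  move=> l0 Qp; apply: dual_on_ge => x Kx.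
  by rewrite dotZl -mulrA ler_wpM2l // dual_on_mul_le.
split=> // [x y Qx Qy|l p l0 Qp].
  apply: dual_on_ge => z Kz.
  by rewrite dotDl mulrDl lerD ?dual_on_mul_le.
apply/eqP; rewrite eq_le geZ // andbT.
have Qlp : quadrant R (l *: p) by exact: (coneZ quadrant_cone).
move: l0; rewrite (le_eqVlt 0 l) => /orP[/eqP l0|l0].
  have [x Kx fx0] := fpos; have := dual_on_mul_le Qlp Kx.
  by rewrite -l0 scale0r mul0r dotE !mxE !mul0r addr0 pmulr_lle0.
rewrite -ler_pdivrMl //.
have := geZ l^-1 _ _ Qlp; rewrite scalerA mulVf ?gt_eqF // scale1r.
by apply; rewrite invr_ge0 ltW.
Qed.

(** Upper semicontinuity holds because the dual is an infimum of linear
    functionals. Lower semicontinuity, also at the boundary of the quadrant,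
    comes from monotonicity: every point of the quadrant near [p] dominates
    [(1 - d) *: p] in each coordinate. *)
Lemma dual_on_continuous : {within quadrant R, continuous (dual_on K f)}.
Proof.
apply/subspace_continuousP => p Qp; apply/cvgrPdist_lt => e e0.
have cont (x : 'rV[R]_2) i :
    (fun y : 'rV[R]_2 => y 0 i) @ within (quadrant R) (nbhs x) --> x 0 i.
  exact: (cvg_within_filter _ (@coord_continuous R 1 2 0 i x)).
have gp0 : 0 <= dual_on K f p by exact: (superlinear_ge0 dual_on_superlinear).
have gpe0 : 0 < dual_on K f p + e by rewrite ltr_wpDl.
(* This [d] is at most 1 and makes [d] times the dual at [p] less than [e]. *)
pose d := e / (dual_on K f p + e).
have d0 : 0 < d by rewrite divr_gt0.
have d1 : d <= 1 by rewrite ler_pdivrMr // mul1r lerDr.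
have dg : d * dual_on K f p < e.
  by rewrite /d mulrAC -mulrA gtr_pMr // ltr_pdivrMr // mul1r ltrDl.
have near_ge i : \forall y \near within (quadrant R) (nbhs p),
    (1 - d) * p 0 i <= (y : 'rV[R]_2) 0 i.
  have [p0|p0] := eqVneq (p 0 i) 0.
    rewrite p0 mulr0; apply: filterS (withinT _ _) => y; exact.
  have pi0 : 0 < p 0 i by rewrite lt_def p0 Qp.
  apply: cvgr_ge; first exact: cont.
  by rewrite gtr_pMl //; lra.
have [x Kx xlt] : exists2 x, K x & dot p x < (dual_on K f p + e) * f x.
  apply: contrapT => nx.
  have : dual_on K f p + e <= dual_on K f p.
    apply: dual_on_ge => x Kx; rewrite leNgt; apply/negP => lt.
    by apply: nx; exists x.
  by rewrite gerDl leNgt e0.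
have fx0 : 0 < f x.
  rewrite -(pmulr_rgt0 _ gpe0); apply: le_lt_trans xlt.
  by apply: dot_quadrant_ge0 => //; exact: (cone_quadrant coneK).
have dotcvg : (fun y : 'rV[R]_2 => dot y x) @ within (quadrant R) (nbhs p) -->
    dot p x.
  rewrite dotE; under eq_fun do rewrite dotE.
  by apply: cvgD; (apply: cvgM; [exact: cont|exact: cvg_cst]).
have near_dot : \forall y \near within (quadrant R) (nbhs p),
    dot y x < (dual_on K f p + e) * f x by exact: (cvgr_lt _ dotcvg).
near=> y.
have Qy : quadrant R y by near: y; exact: withinT.
have ylt : dual_on K f y < dual_on K f p + e.
  rewrite -(ltr_pM2r fx0); apply: le_lt_trans (dual_on_mul_le Qy Kx) _.
  by near: y.
have yge : (1 - d) * dual_on K f p <= dual_on K f y.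
  apply: dual_on_ge => z Kz; rewrite -mulrA.
  apply: (@le_trans _ _ ((1 - d) * dot p z)).
    by rewrite ler_wpM2l ?dual_on_mul_le //; lra.
  have /quadrantP[z0 z1] := cone_quadrant coneK Kz.
  rewrite !dotE mulrDr !mulrA lerD // ler_wpM2r //; near: y; exact: near_ge.
by rewrite ltr_norml; lra.
Unshelve. all: by end_near. Qed.

End Duals.

(** * Supporting functionals *)

Section Support.
Context {R : realType}.
Implicit Types x y p q : 'rV[R]_2.

(** Write the wanted functional as [f p * dot p / dot p p + d * det2 p]. It
    dominates [f] at [x] iff [d] lies on the correct side of the slope of [f]
    at [x]; the slopes from one side of [p] are below those from the other
    side because a positive combination of two points on opposite sides is a
    multiple of [p]. *)
Lemma supporting_functional (K : set 'rV[R]_2) (f : 'rV[R]_2 -> R) p :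
  convex_cone K -> superlinear K f -> K p ->
  (exists2 x, K x & 0 < det2 p x) -> (exists2 y, K y & det2 p y < 0) ->
  exists2 q, dot q p = f p & forall x, K x -> f x <= dot q x.
Proof.
move=> coneK supf Kp [x1 Kx1 x1p] [y1 Ky1 y1p].
have QK := cone_quadrant coneK.
have pp0 : 0 < dot p p.
  rewrite lt_def dot_quadrant_ge0 ?andbT; try exact: QK.
  apply: contraTN x1p; rewrite dotE -!expr2 paddr_eq0 ?sqr_ge0 // !sqrf_eq0.
  by move=> /andP[/eqP p0 /eqP p1]; rewrite /det2 p0 p1 !mul0r subrr ltxx.
have ppn : dot p p != 0 by rewrite gt_eqF.
have onray z : K z -> det2 p z = 0 -> f z = dot p z / dot p p * f p.
  move=> Kz pz; rewrite {1}(det2_eq0_colinear ppn pz) (superlinearZ supf) //.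
  by rewrite divr_ge0 ?dot_quadrant_ge0 //; exact: QK.
pose gap z := f z - dot p z / dot p p * f p.
pose slope z := gap z / det2 p z.
have slope_le x y : K x -> 0 < det2 p x -> K y -> det2 p y < 0 ->
    slope x <= slope y.
  move=> Kx x0 Ky y0.
  have x0' := ltW x0; have y0' : 0 <= - det2 p y by rewrite oppr_ge0 ltW.
  have Kx' := coneZ coneK y0' Kx; have Ky' := coneZ coneK x0' Ky.
  have := superlinearD supf Kx' Ky'; rewrite [f (_ + _)]onray; last 2 first.
  - exact: (coneD coneK).
  - by rewrite /det2 !mxE; ring.
  rewrite !(superlinearZ supf) // dotDr !dotZr => le.
  have : det2 p x * gap y <= det2 p y * gap x by rewrite /gap; lra.
  move=> {}le; rewrite /slope ler_pdivrMr // mulrAC ler_ndivlMr //.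
  by rewrite mulrC [X in _ <= X]mulrC.
pose S := [set slope x | x in [set x | K x /\ 0 < det2 p x]].
have supS : has_ubound S.
  by exists (slope y1) => _ [x [Kx x0] <-]; exact: slope_le.
have S0 : S !=set0 by exists (slope x1), x1.
pose d := sup S.
exists (vec2 (f p / dot p p * p 0 0 - d * p 0 1)
             (f p / dot p p * p 0 1 + d * p 0 0)).
  transitivity (f p / dot p p * dot p p); last by rewrite divfK.
  by rewrite !dotE !mxE /=; ring.
move=> x Kx.
suff gapd : gap x <= d * det2 p x.
  move: gapd; rewrite /gap lerBlDl; congr (_ <= _).
  by rewrite [in RHS]dotE /det2 !mxE /= {1}dotE; ring.
have [x0|x0|x0] := ltgtP (det2 p x) 0.
- rewrite -ler_ndivlMr //; apply: ge_sup => // _ [z [Kz z0] <-].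
  exact: slope_le.
- by rewrite -ler_pdivrMr //; apply: ub_le_sup => //; exists x.
- by rewrite x0 mulr0 /gap onray // subrr.
Qed.

End Support.

(** * The two angles cut out by a ray *)

Section Angles.
Context {R : realType}.
Variable a : 'rV[R]_2.
Hypotheses (Qa : quadrant R a) (aa1 : dot a a = 1).
Implicit Types (x y p : 'rV[R]_2) (i j : 'I_2).

(** The factor [(-1) ^+ i] turns the half-plane of either label into the same
    inequality, so that the two angles can be handled together. When [a] lies on
    a half-axis the vectors [delta_mx 0 i] and [a] need not form a basis, hence
    the case distinctions. *)
Lemma subangleP i x :
  subangle a i x <-> quadrant R x /\ 0 <= (-1) ^+ i * det2 x a.
Proof.
have /quadrantP[a0 a1] := Qa.
split=> [[s [t [s0 t0 ->]]]|[/quadrantP[x0 x1]]].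
  have sa0 := mulr_ge0 s0 a0; have sa1 := mulr_ge0 s0 a1.
  have ta0 := mulr_ge0 t0 a0; have ta1 := mulr_ge0 t0 a1.
  split; first by apply/quadrantP; rewrite !mxE /=;
    case: (ord2_case i) => -> /=; split; lra.
  by rewrite /det2 !mxE /=; case: (ord2_case i) => -> /=;
    rewrite ?expr0 ?expr1; lra.
move: aa1; rewrite /det2 dotE => aa.
case: (ord2_case i) => -> /=; rewrite ?expr0 ?expr1 => side.
- have [a10|a10] := eqVneq (a 0 1) 0.
    have a00 : a 0 0 != 0.
      by apply/eqP => a00; move: aa; rewrite a00 a10 !mul0r addr0; lra.
    have a0_gt0 : 0 < a 0 0 by rewrite lt_def a00.
    have x10 : x 0 1 = 0.
      apply/eqP; rewrite eq_le x1 andbT -(pmulr_lle0 _ a0_gt0).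
      by move: side; rewrite a10; lra.
    exists (x 0 0), 0; split=> //.
    by apply: rowP2; rewrite !mxE /= ?x10; ring.
  have a1_gt0 : 0 < a 0 1 by rewrite lt_def a10.
  exists ((x 0 0 * a 0 1 - x 0 1 * a 0 0) / a 0 1), (x 0 1 / a 0 1).
  split; [by rewrite divr_ge0 //; lra|by rewrite divr_ge0|].
  by apply: rowP2; rewrite !mxE /=; field.
- have [a00|a00] := eqVneq (a 0 0) 0.
    have a10 : a 0 1 != 0.
      by apply/eqP => a10; move: aa; rewrite a00 a10 !mul0r addr0; lra.
    have a1_gt0 : 0 < a 0 1 by rewrite lt_def a10.
    have x00 : x 0 0 = 0.
      apply/eqP; rewrite eq_le x0 andbT -(pmulr_lle0 _ a1_gt0).
      by move: side; rewrite a00; lra.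
    exists (x 0 1), 0; split=> //.
    by apply: rowP2; rewrite !mxE /= ?x00; ring.
  have a0_gt0 : 0 < a 0 0 by rewrite lt_def a00.
  exists ((x 0 1 * a 0 0 - x 0 0 * a 0 1) / a 0 0), (x 0 0 / a 0 0).
  split; [by rewrite divr_ge0 //; lra|by rewrite divr_ge0|].
  by apply: rowP2; rewrite !mxE /=; field.
Qed.

Lemma subangle_opposite i j x : i != j ->
  subangle a j x <-> quadrant R x /\ (-1) ^+ i * det2 x a <= 0.
Proof.
move=> ij; rewrite (propext (subangleP _ _)).
suff -> : (-1) ^+ j = - (-1) ^+ i :> R by rewrite mulNr oppr_ge0.
by move: ij; case: (ord2_case i) => ->; case: (ord2_case j) => -> //= _;
  rewrite ?expr0 ?expr1 ?opprK.
Qed.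

Lemma subangle_cone i : convex_cone (subangle a i).
Proof.
split=> [x /subangleP[]|x y|l x l0] //.
- move=> /subangleP[Qx sx] /subangleP[Qy sy]; apply/subangleP.
  split; first exact: (coneD quadrant_cone).
  suff -> : det2 (x + y) a = det2 x a + det2 y a by rewrite mulrDr addr_ge0.
  by rewrite /det2 !mxE; ring.
- move=> /subangleP[Qx sx]; apply/subangleP.
  split; first exact: (coneZ quadrant_cone).
  suff -> : det2 (l *: x) a = l * det2 x a by rewrite mulrCA mulr_ge0.
  by rewrite /det2 !mxE; ring.
Qed.

Lemma subangle_ray i : subangle a i a.
Proof. by exists 0, 1; rewrite scale0r add0r scale1r. Qed.

Lemma subangle_axis i : subangle a i (delta_mx 0 i).
Proof. by exists 1, 0; rewrite scale0r addr0 scale1r. Qed.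

Lemma subangle_cover i j x :
  i != j -> quadrant R x -> subangle a i x \/ subangle a j x.
Proof.
move=> ij Qx; have [s|s] := leP 0 ((-1) ^+ i * det2 x a).
- by left; apply/subangleP.
- by right; apply/(subangle_opposite _ ij); split=> //; exact: ltW.
Qed.

Lemma sign_det2_eq0 i x : ((-1) ^+ i * det2 x a = 0) -> det2 x a = 0.
Proof. by move/eqP; rewrite mulf_eq0 signr_eq0 => /eqP. Qed.

Lemma det2_ray x : det2 x a = 0 -> x = dot a x *: a.
Proof.
move=> xa; have := @det2_eq0_colinear _ a x; rewrite aa1 oner_neq0 divr1.
apply=> //; transitivity (- det2 x a); last by rewrite xa oppr0.
by rewrite /det2; ring.
Qed.

(** On one side of the ray the components orthogonal to [a] have equal signs,
    so their product only adds to the inner product. *)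
Lemma same_side_dot i x p :
  subangle a i x -> subangle a i p -> dot a x * dot a p <= dot x p.
Proof.
move=> /subangleP[_ sx] /subangleP[_ sp].
have := mulr_ge0 sx sp.
have -> : (-1) ^+ i * det2 x a * ((-1) ^+ i * det2 p a) =
    (-1) ^+ i * (-1) ^+ i * (det2 a x * det2 a p) :> R by rewrite /det2; ring.
rewrite -expr2 sqrr_sign mul1r => dd.
by rewrite -[leRHS]mul1r -aa1 dot_frame lerDl.
Qed.

(** If [f <= dot a] with equality on the ray, then [dot a] supports [f] on the
    ray, and concavity passes across it: [x + y] is the sum of a multiple of
    [x] and of a vector [w] of the ray, where [f w = dot a w]. *)
Lemma superadditive_across i j (f : 'rV[R]_2 -> R) x y :
  superlinear (subangle a i) f ->
  (forall z, quadrant R z -> f z <= dot a z) -> f a = 1 -> i != j ->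
  subangle a i x -> subangle a j y -> subangle a i (x + y) ->
  f x + f y <= f (x + y).
Proof.
move=> supf fle fa ij Kx Ky Kxy.
have coneK := subangle_cone i.
have fray w : quadrant R w -> det2 w a = 0 -> f w = dot a w.
  move=> Qw wa; rewrite {1}(det2_ray wa) (superlinearZ supf) ?fa ?mulr1 //.
    exact: dot_quadrant_ge0.
  exact: subangle_ray.
have /subangleP[Qx sx] := Kx; have /(subangle_opposite _ ij)[Qy sy] := Ky.
have /subangleP[Qxy sxy] := Kxy.
have sD : (-1) ^+ i * det2 (x + y) a =
    (-1) ^+ i * det2 x a + (-1) ^+ i * det2 y a :> R.
  by rewrite -mulrDr /det2 !mxE; congr (_ * _); ring.
rewrite sD in sxy.
have [m [m0 m1 wray]] :
    exists m : R, [/\ 0 <= m, m <= 1 & det2 (m *: x + y) a = 0].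
  pose D := (-1) ^+ i * det2 x a; pose E := - ((-1) ^+ i * det2 y a).
  (* If [D = 0] then also [E = 0], and [E / D] has the suitable value 0. *)
  exists (E / D); have E0 : 0 <= E by rewrite oppr_ge0.
  split; first by rewrite divr_ge0.
    have [->|D0] := eqVneq D 0; first by rewrite invr0 mulr0 ler01.
    by rewrite ler_pdivrMr ?lt_def ?D0 // mul1r /E /D; lra.
  apply: (@sign_det2_eq0 i).
  have -> k : (-1) ^+ i * det2 (k *: x + y) a = k * D - E.
    by rewrite /E /D /det2 !mxE; ring.
  have [D0|D0] := eqVneq D 0; last by rewrite divfK // subrr.
  by move: sxy E0; rewrite -/D D0 mulr0 /E; lra.
have Qw : quadrant R (m *: x + y).
  by apply: (coneD quadrant_cone) => //; exact: (coneZ quadrant_cone).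
have Kw : subangle a i (m *: x + y) by apply/subangleP; rewrite wray mulr0.
have m1' : 0 <= 1 - m by rewrite subr_ge0.
have -> : x + y = (1 - m) *: x + (m *: x + y).
  by rewrite addrA -scalerDl subrK scale1r.
have := superlinearD supf (coneZ coneK m1' Kx) Kw.
rewrite (superlinearZ supf) // (fray _ Qw wray) dotDr dotZr.
by have := ler_wpM2l m0 (fle _ Qx); have := fle _ Qy; lra.
Qed.

End Angles.

(** * The construction yields self-dual antinorms *)

Section Construction.
Context {R : realType}.
Implicit Types (a x y p q : 'rV[R]_2) (i j : 'I_2) (f g : 'rV[R]_2 -> R).

Lemma le_limit_along_ray (K : set 'rV[R]_2) f p a (c : R) :
  {within K, continuous f} -> (forall t : R, 0 <= t -> K (p + t *: a)) ->
  (forall t : R, 0 < t -> c <= f (p + t *: a)) -> c <= f p.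
Proof.
move=> /subspace_continuousP contf Kray cle.
have Kp : K p by have := Kray 0 (lexx _); rewrite scale0r addr0.
rewrite leNgt; apply/negP => fpc.
have nearp : \forall y \near nbhs p, K y -> f y < c.
  exact: (cvgr_lt _ (contf _ Kp) _ fpc).
have raycvg : (fun t : R => p + t *: a) @ (0 : R)^'+ --> p.
  rewrite -[X in _ --> X](_ : p + 0 *: a = p); last by rewrite scale0r addr0.
  apply: cvgD; first exact: cvg_cst.
  by apply: cvgZr_tmp; apply: cvg_at_right_filter; exact: cvg_id.
have nearray : \forall t \near (0 : R)^'+, K (p + t *: a) -> f (p + t *: a) < c.
  exact: raycvg _ nearp.
near (0 : R)^'+ => t.
have t0 : 0 < t by near: t; exact: nbhs_right_gt.
have : f (p + t *: a) < c.
  have Kt : K (p + t *: a) by exact/Kray/ltW.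
  by move: Kt; near: t.
by rewrite ltNge cle.
Unshelve. all: by end_near. Qed.

Lemma eq_dual_on (K : set 'rV[R]_2) f g p :
  (forall x, K x -> f x = g x) -> dual_on K f p = dual_on K g p.
Proof.
move=> fg; rewrite /dual_on; congr inf; apply/seteqP; split=> _ [x [Kx x0] <-];
  by exists x; rewrite /= ?fg ?(fg x Kx) // -fg.
Qed.

Lemma antinorm_eq (K : set 'rV[R]_2) f g :
  convex_cone K -> (forall x, K x -> f x = g x) -> antinorm K f -> antinorm K g.
Proof.
move=> coneK fg anf; apply: antinorm_superlinear => //.
- by apply: (eq_superlinear coneK fg); exact: superlinear_antinorm.
- by have [x Kx fx] := antinorm_pos anf; exists x => //; rewrite -fg.
- apply: (@subspace_eq_continuous _ K _ f); last exact: antinorm_continuous anf.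
  by move=> x; rewrite inE; exact: fg.
Qed.

(** Only the values of [f1] on the first angle matter, and there it agrees with
    the glued functional, which may therefore take its place. *)
Lemma construction_restrict a i j f1 f :
  construction_data a i j f1 -> glued a i j f1 f ->
  construction_data a i j f /\ glued a i j f f.
Proof.
move=> [Qa a1 ij an fa fle] [ff1 fdual].
have f1f x : subangle a i x -> f1 x = f x by move/ff1.
split; split=> //.
- exact: (antinorm_eq (subangle_cone Qa ((enorm1E a).1 a1) i) f1f).
- by rewrite ff1 //; exact: subangle_ray.
- by move=> x Kx; rewrite ff1 ?fle.
- by move=> x Kx; rewrite fdual //; exact: eq_dual_on.
Qed.

Variables (a : 'rV[R]_2) (i j : 'I_2) (f : 'rV[R]_2 -> R).
Hypotheses (data : construction_data a i j f) (glf : glued a i j f f).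

Let Qa : quadrant R a. Proof. by case: data. Qed.
Let aa1 : dot a a = 1. Proof. by apply/enorm1E; case: data. Qed.
Let ij : i != j. Proof. by case: data. Qed.
Let ji : j != i. Proof. by rewrite eq_sym. Qed.
Let fa : f a = 1. Proof. by case: data. Qed.
Let coneKi : convex_cone (subangle a i). Proof. exact: subangle_cone. Qed.
Let coneKj : convex_cone (subangle a j). Proof. exact: subangle_cone. Qed.
Let supi : superlinear (subangle a i) f.
Proof. by apply: superlinear_antinorm => //; case: data. Qed.
Let fposi : exists2 x, subangle a i x & 0 < f x.
Proof. by exists a; [exact: subangle_ray|rewrite fa]. Qed.
Let fdual : forall x, subangle a j x -> f x = dual_on (subangle a i) f x.
Proof. by case: glf. Qed.
Let Qj : forall x, subangle a j x -> quadrant R x.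
Proof. exact: (cone_quadrant coneKj). Qed.
Let Qi : forall x, subangle a i x -> quadrant R x.
Proof. exact: (cone_quadrant coneKi). Qed.

Lemma glued_le x : quadrant R x -> f x <= dot a x.
Proof.
move=> Qx; have [Kx|Kx] := subangle_cover Qa aa1 ij Qx.
  by case: data => _ _ _ _ _; apply.
have := dual_on_mul_le coneKi supi Qx (subangle_ray a i).
by rewrite -(fdual Kx) fa mulr1 dotC.
Qed.

Lemma glued_superlinear : superlinear (quadrant R) f.
Proof.
have supj : superlinear (subangle a j) f.
  apply: (@eq_superlinear _ _ (dual_on (subangle a i) f)) => //.
    by move=> x Kx; rewrite fdual.
  by apply: (superlinear_sub _ (dual_on_superlinear coneKi supi fposi)).
split=> [x Qx|x y Qx Qy|l x l0 Qx].
- by have [/(superlinear_ge0 supi)|/(superlinear_ge0 supj)] :=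
    subangle_cover Qa aa1 ij Qx.
- have Qxy := coneD quadrant_cone Qx Qy.
  have [Kx|Kx] := subangle_cover Qa aa1 ij Qx;
  have [Ky|Ky] := subangle_cover Qa aa1 ij Qy.
  + exact: (superlinearD supi Kx Ky).
  + have [Kxy|Kxy] := subangle_cover Qa aa1 ij Qxy.
      exact: (superadditive_across Qa aa1 supi glued_le fa ij Kx Ky Kxy).
    rewrite addrC in Kxy; rewrite addrC [x + y]addrC.
    exact: (superadditive_across Qa aa1 supj glued_le fa ji Ky Kx Kxy).
  + have [Kxy|Kxy] := subangle_cover Qa aa1 ij Qxy.
      rewrite addrC in Kxy; rewrite addrC [x + y]addrC.
      exact: (superadditive_across Qa aa1 supi glued_le fa ij Ky Kx Kxy).
    exact: (superadditive_across Qa aa1 supj glued_le fa ji Kx Ky Kxy).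
  + exact: (superlinearD supj Kx Ky).
- have [Kx|Kx] := subangle_cover Qa aa1 ij Qx.
  + exact: (superlinearZ supi).
  + exact: (superlinearZ supj).
Qed.

Let sup := glued_superlinear.

(** Across the ray this is the definition of [f] on the second angle; on one
    side of the ray it follows from [f <= dot a] and [same_side_dot]. *)
Lemma glued_mul_le x p : quadrant R x -> quadrant R p -> f p * f x <= dot p x.
Proof.
have same k y z : subangle a k y -> subangle a k z -> f y * f z <= dot y z.
  move=> Ky Kz; apply: le_trans (same_side_dot Qa aa1 Ky Kz).
  have Qy : quadrant R y := cone_quadrant (subangle_cone Qa aa1 k) Ky.
  have Qz : quadrant R z := cone_quadrant (subangle_cone Qa aa1 k) Kz.
  by apply: ler_pM; rewrite ?glued_le ?(superlinear_ge0 sup).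
have opp y z : subangle a i y -> subangle a j z -> f z * f y <= dot z y.
  by move=> Ky Kz; rewrite (fdual Kz); apply: dual_on_mul_le => //; exact: Qj.
move=> Qx Qp; have [Kx|Kx] := subangle_cover Qa aa1 ij Qx;
  have [Kp|Kp] := subangle_cover Qa aa1 ij Qp.
- exact: same Kp Kx.
- exact: opp Kx Kp.
- by rewrite mulrC dotC; exact: opp Kp Kx.
- exact: same Kp Kx.
Qed.

Let fpos : exists2 x, quadrant R x & 0 < f x.
Proof. by exists a; rewrite ?fa. Qed.

(** The bipolar argument. A functional [q] that supports [f] on the first
    angle at an interior point [p] satisfies [dot q a >= f a = dot a a] and
    [dot q p = f p <= dot a p], so that [q] lies across the ray from [p]; there
    the definition of [f] gives [f q >= 1], and [q] witnesses that the dual at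
    [p] is at most [f p]. *)
Lemma dual_glued_le_interior p :
  subangle a i p -> 0 < (-1) ^+ i * det2 p a ->
  (-1) ^+ i * det2 p (delta_mx 0 i) < 0 -> dual f p <= f p.
Proof.
move=> Kp pa pe; have Qp := Qi Kp.
(* The half-axis and the ray are on opposite sides of [p], whence the hypotheses
   on both sides for a supporting functional. *)
have [q qp fq] : exists2 q, dot q p = f p &
    forall x, subangle a i x -> f x <= dot q x.
  apply: (supporting_functional coneKi supi Kp); move: pa pe;
    case: (ord2_case i) => ->; rewrite ?expr0 ?expr1 => pa pe.
  - by exists a; [exact: subangle_ray|lra].
  - by exists (delta_mx 0 1); [exact: subangle_axis|lra].
  - by exists (delta_mx 0 0); [exact: subangle_axis|lra].
  - by exists a; [exact: subangle_ray|lra].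
have qa1 : 1 <= dot a q by rewrite -fa dotC; apply: fq; exact: subangle_ray.
have qa : (-1) ^+ i * det2 q a <= 0.
  have frame := dot_frame a q p; rewrite aa1 mul1r qp in frame.
  have fp := glued_le Qp.
  have le_ap : dot a p <= dot a q * dot a p.
    by rewrite ler_peMl // dot_quadrant_ge0.
  rewrite -(pmulr_lle0 _ pa).
  have -> : (-1) ^+ i * det2 q a * ((-1) ^+ i * det2 p a) =
      ((-1) ^+ i) ^+ 2 * (det2 a q * det2 a p) :> R by rewrite /det2; ring.
  by rewrite sqrr_sign mul1r; lra.
(* One coordinate of [q] is nonnegative because [dot q] dominates [f] on the
   half-axis; the other one because [q] lies across the ray. *)
have Qq : quadrant R q.
  have /quadrantP[a0 a1] := Qa.
  have qe : 0 <= dot q (delta_mx 0 i).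
    apply: le_trans (fq _ (subangle_axis a i)).
    exact/(superlinear_ge0 supi)/subangle_axis.
  apply/quadrantP; move: qa qe qa1; rewrite !dotE /det2.
  case: (ord2_case i) => ->; rewrite ?expr0 ?expr1 !mxE /= => qa qe qa1.
  - have q0 : 0 <= q 0 0 by lra.
    split=> //; have [a00|a00] := eqVneq (a 0 0) 0.
      have a11 : a 0 1 * a 0 1 = 1 by move: aa1; rewrite dotE a00; lra.
      have a1p : 0 < a 0 1 by rewrite lt_def a1 andbT; apply/eqP => E;
        move: a11; rewrite E; lra.
      by rewrite -(pmulr_rge0 _ a1p); move: qa1; rewrite a00; lra.
    have a0p : 0 < a 0 0 by rewrite lt_def a00.
    by rewrite -(pmulr_rge0 _ a0p); have := mulr_ge0 q0 a1; lra.
  - have q1 : 0 <= q 0 1 by lra.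
    split=> //; have [a10|a10] := eqVneq (a 0 1) 0.
      have a11 : a 0 0 * a 0 0 = 1 by move: aa1; rewrite dotE a10; lra.
      have a0p : 0 < a 0 0 by rewrite lt_def a0 andbT; apply/eqP => E;
        move: a11; rewrite E; lra.
      by rewrite -(pmulr_rge0 _ a0p); move: qa1; rewrite a10; lra.
    have a1p : 0 < a 0 1 by rewrite lt_def a10.
    by rewrite -(pmulr_rge0 _ a1p); have := mulr_ge0 q1 a0; lra.
have Kq : subangle a j q by apply/(subangle_opposite Qa aa1 _ ij).
have fq1 : 1 <= f q.
  by rewrite fdual //; apply: dual_on_ge => // x Kx; rewrite mul1r fq.
rewrite -qp dotC; apply: le_trans (dual_on_mul_le quadrant_cone sup Qp Qq).
rewrite ler_peMr //.
exact/(superlinear_ge0 (dual_on_superlinear quadrant_cone sup fpos)).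
Qed.

(** The interior case reaches every [p] of the first angle off the ray by
    moving along [p + t *: a] with [t] tending to [0]: the dual only grows on
    the way, and [f] is continuous on the angle. *)
Lemma dual_glued_le p : subangle a i p -> dual f p <= f p.
Proof.
move=> Kp; have Qp := Qi Kp.
have supd : superlinear (quadrant R) (dual f).
  exact: (dual_on_superlinear quadrant_cone sup fpos).
have [pa|pa] := eqVneq (det2 p a) 0.
  have := dual_on_mul_le quadrant_cone sup Qp Qa; rewrite fa mulr1 dotC.
  rewrite [X in _ -> _ <= f X](det2_ray aa1 pa).
  rewrite (superlinearZ sup) ?fa ?mulr1 //.
  exact: dot_quadrant_ge0.
have /(subangleP Qa aa1)[_ sp] := Kp.
have spa : 0 < (-1) ^+ i * det2 p a.
  by rewrite lt_def sp andbT mulf_neq0 ?signr_eq0.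
have Kray (t : R) : 0 <= t -> subangle a i (p + t *: a).
  by move=> t0; apply: (coneD coneKi) => //; apply: (coneZ coneKi) => //;
    exact: subangle_ray.
apply: (le_limit_along_ray (a := a) _ Kray).
  by apply: antinorm_continuous; case: data.
move=> t t0; have Kt := Kray t (ltW t0).
apply: (@le_trans _ _ (dual f (p + t *: a))).
  have Qta : quadrant R (t *: a) by apply: (coneZ quadrant_cone); rewrite ?ltW.
  apply: le_trans (superlinearD supd Qp Qta).
  by rewrite lerDl; exact: (superlinear_ge0 supd).
have tpa : (-1) ^+ i * det2 (p + t *: a) a = (-1) ^+ i * det2 p a.
  by rewrite /det2 !mxE; ring.
apply: dual_glued_le_interior => //; first by rewrite tpa.
have /quadrantP[a0 a1] := Qa; have /quadrantP[p0 p1] := Qp.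
move: spa; rewrite /det2; case: (ord2_case i) => ->;
  rewrite ?expr0 ?expr1 !mxE /= => spa.
- have a1p : 0 < a 0 1.
    rewrite lt_def a1 andbT; apply/eqP => E; move: spa; rewrite E.
    by have := mulr_ge0 p1 a0; lra.
  by have := mulr_gt0 t0 a1p; lra.
- have a0p : 0 < a 0 0.
    rewrite lt_def a0 andbT; apply/eqP => E; move: spa; rewrite E.
    by have := mulr_ge0 p0 a1; lra.
  by have := mulr_gt0 t0 a0p; lra.
Qed.

Lemma glued_self_dual : self_dual f.
Proof.
move=> p Qp; apply/eqP; rewrite eq_le; apply/andP; split; last first.
  by apply: (dual_on_ge sup fpos) => x Qx; exact: glued_mul_le.
have [Kp|Kp] := subangle_cover Qa aa1 ij Qp; first exact: dual_glued_le.
rewrite [leRHS]fdual //; apply: (dual_on_ge supi fposi) => x Kx.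
by apply: (dual_on_mul_le quadrant_cone sup) => //; exact: Qi.
Qed.

Lemma glued_antinorm : antinorm (quadrant R) f.
Proof.
apply: (antinorm_superlinear quadrant_cone sup fpos).
apply: (@subspace_eq_continuous _ _ _ (dual f)).
  by move=> p; rewrite inE; exact: glued_self_dual.
exact: (dual_on_continuous quadrant_cone sup fpos).
Qed.

End Construction.

(** The two prescriptions agree on the common ray: the dual of [f1] at [a] is 1
    because [f1 <= dot a] with equality at [a]. *)
Lemma glued_exists (R : realType) (a : 'rV[R]_2) (i j : 'I_2)
    (f1 : 'rV[R]_2 -> R) :
  construction_data a i j f1 -> exists f : 'rV[R]_2 -> R, glued a i j f1 f.
Proof.
move=> [Qa /enorm1E aa1 ij an fa fle].
have coneK := subangle_cone Qa aa1 i.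
have supf := superlinear_antinorm coneK an.
have fpos := antinorm_pos an.
have supd := dual_on_superlinear coneK supf fpos.
exists (fun x => if `[< subangle a i x >] then f1 x
                 else dual_on (subangle a i) f1 x).
split=> x Kx; first by rewrite asboolT.
case: asboolP => // Kix.
have /(subangleP Qa aa1)[Qx sx] := Kix.
have /(subangle_opposite Qa aa1 _ ij)[_ sx'] := Kx.
have xa : det2 x a = 0.
  by apply: (@sign_det2_eq0 _ a i); apply/eqP; rewrite eq_le sx sx'.
have ax0 : 0 <= dot a x by exact: dot_quadrant_ge0.
rewrite (det2_ray aa1 xa) (superlinearZ supd) // (superlinearZ supf) //;
  last exact: subangle_ray.
congr (_ * _); rewrite fa; apply/eqP; rewrite eq_le; apply/andP; split.
  by apply: dual_on_ge => // y Ky; rewrite mul1r fle.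
have := dual_on_mul_le coneK supf Qa (subangle_ray a i).
by rewrite fa mulr1 aa1.
Qed.

(** * Every self-dual antinorm is obtained *)

Section Converse.
Context {R : realType}.
Implicit Types (x y p : 'rV[R]_2) (f g : 'rV[R]_2 -> R).

Lemma self_dual_mul_le f x p : antinorm (quadrant R) f -> self_dual f ->
  quadrant R x -> quadrant R p -> f p * f x <= dot p x.
Proof.
move=> an sd Qx Qp; rewrite -{1}(sd _ Qp).
by apply: (dual_on_mul_le quadrant_cone) => //;
  exact: (superlinear_antinorm quadrant_cone).
Qed.

(** By homogeneity the ratio of [f] to the Euclidean norm need only be
    maximised on the segment that joins the two unit vectors of the axes, which
    is compact. *)
Lemma maximal_direction f : antinorm (quadrant R) f ->
  exists a, [/\ quadrant R a, dot a a = 1, 0 < f a &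
    forall x, quadrant R x -> f x ^+ 2 <= f a ^+ 2 * dot x x].
Proof.
move=> an; have supf := superlinear_antinorm quadrant_cone an.
have Q0 : quadrant R 0 by move=> k; rewrite mxE.
have f0 : f 0 = 0 by rewrite -(scale0r 0) (superlinearZ supf) // mul0r.
pose v (t : R) : 'rV[R]_2 := (1 - t) *: delta_mx 0 0 + t *: delta_mx 0 1.
have v0 t : v t 0 0 = 1 - t by rewrite !mxE /=; ring.
have v1 t : v t 0 1 = t by rewrite !mxE /=; ring.
have Qv t : t \in `[0, 1]%R -> quadrant R (v t).
  by rewrite in_itv /= => /andP[t0 t1]; apply/quadrantP; rewrite v0 v1 subr_ge0.
have vv t : 0 < dot (v t) (v t).
  by rewrite dotE v0 v1; have := sqr_ge0 (1 - t *+ 2); lra.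
have vcont t : v @ t --> v t.
  apply: cvgD; apply: cvgZr_tmp; last exact: cvg_id.
  by apply: cvgB; [exact: cvg_cst|exact: cvg_id].
pose h t := f (v t) ^+ 2 / dot (v t) (v t).
have hcont : {within `[0, 1], continuous h}.
  apply/subspace_continuousP => t t01.
  have fv : f \o v @ within `[0, 1] (nbhs t) --> f (v t).
    have /subspace_continuousP/(_ _ (Qv _ t01)) fc := antinorm_continuous an.
    apply: cvg_comp fc => A vA.
    have nearv : \forall s \near t, quadrant R (v s) -> A (v s).
      exact: vcont t (fun y => quadrant R y -> A y) vA.
    by apply: filterS nearv => s vsA s01; exact: vsA (Qv s s01).
  have vc k : (fun s => v s 0 k) @ within `[0, 1] (nbhs t) --> v t 0 k.
    apply: cvg_within_filter.
    exact: (cvg_comp _ _ (vcont t) (@coord_continuous R 1 2 0 k (v t))).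
  apply: cvgM; first by rewrite expr2; apply: cvgM.
  apply: cvgV; first by rewrite gt_eqF.
  under eq_fun do rewrite dotE; rewrite dotE.
  by apply: cvgD; apply: cvgM.
have [t t01 tmax] := EVT_max ler01 hcont.
pose n := Num.sqrt (dot (v t) (v t)).
have n0 : 0 < n by rewrite sqrtr_gt0.
have nn : n ^+ 2 = dot (v t) (v t) by rewrite sqr_sqrtr // ltW.
have n0' : 0 <= n^-1 by rewrite invr_ge0 ltW.
have fan : f (n^-1 *: v t) ^+ 2 = h t.
  rewrite (superlinearZ supf) //; last exact: Qv.
  by rewrite exprMn /h -nn exprVn mulrC.
have bound x : quadrant R x -> f x ^+ 2 <= h t * dot x x.
  move=> Qx; have /quadrantP[x0 x1] := Qx.
  have [->|xn] := eqVneq x 0.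
    by rewrite f0 expr0n /= dotE !mxE mulr0 addr0 mulr0.
  have s0 : 0 < x 0 0 + x 0 1.
    rewrite lt_def addr_ge0 // andbT paddr_eq0 //; apply: contra xn.
    by move=> /andP[/eqP e0 /eqP e1]; apply/eqP/rowP2; rewrite !mxE.
  set s := x 0 0 + x 0 1 in s0; pose u := x 0 1 / s.
  have u01 : u \in `[0, 1]%R.
    rewrite in_itv /= /u (divr_ge0 x1 (ltW s0)) /=.
    by rewrite (ler_pdivrMr _ _ s0) mul1r /s lerDr.
  have -> : x = s *: v u.
    by apply: rowP2; rewrite mxE ?v0 ?v1 /u /s; field; exact: lt0r_neq0.
  rewrite (superlinearZ supf (ltW s0)); last exact: Qv.
  have -> : h t * dot (s *: v u) (s *: v u) = s ^+ 2 * (h t * dot (v u) (v u)).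
    by rewrite dotZl dotZr; ring.
  by rewrite exprMn ler_wpM2l ?sqr_ge0 // -(ler_pdivrMr _ _ (vv u)) tmax.
have aa : dot (n^-1 *: v t) (n^-1 *: v t) = 1.
  by rewrite dotZl dotZr -nn expr2; field; exact: lt0r_neq0.
have Qa : quadrant R (n^-1 *: v t).
  by apply: (coneZ quadrant_cone) => //; exact: Qv.
exists (n^-1 *: v t); split=> //; last by rewrite fan.
rewrite lt_def (superlinear_ge0 supf) // andbT; apply/eqP => fa0.
have [x Qx fx] := antinorm_pos an.
have := bound x Qx; rewrite -fan fa0 expr0n mul0r.
by rewrite leNgt exprn_gt0.
Qed.

(** First-order condition at the maximiser: compare [f] and the norm at
    [a + t *: x] for a small [t]. *)
Lemma maximal_direction_support f a : superlinear (quadrant R) f ->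
  quadrant R a -> dot a a = 1 -> 0 < f a ->
  (forall x, quadrant R x -> f x ^+ 2 <= f a ^+ 2 * dot x x) ->
  forall x, quadrant R x -> f x <= f a * dot a x.
Proof.
move=> supf Qa aa1 fa0 fmax x Qx.
pose w := f a ^+ 2 * dot x x.
have w0 : 0 <= w by rewrite mulr_ge0 ?sqr_ge0 ?dot_quadrant_ge0.
have fx0 : 0 <= f x by exact: (superlinear_ge0 supf).
rewrite leNgt; apply/negP => lt.
pose e := f x - f a * dot a x; have e0 : 0 < e by rewrite subr_gt0.
have fe0 : 0 < f a * e by rewrite mulr_gt0.
(* The comparison reads [2 * (f a * e) <= t * w] up to a nonnegative term; this
   [t] makes it fail. *)
pose t := f a * e / (w + 1).
have w1 : 0 < w + 1 by rewrite ltr_wpDl.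
have t0 : 0 < t by rewrite divr_gt0.
have tw : t * (w + 1) = f a * e by rewrite /t divfK // gt_eqF.
have Qtx : quadrant R (t *: x) by apply: (coneZ quadrant_cone); rewrite ?ltW.
have := fmax _ (coneD quadrant_cone Qa Qtx).
have fsum : f a + t * f x <= f (a + t *: x).
  by rewrite -(superlinearZ supf (ltW t0)) // (superlinearD supf).
have ge0 : 0 <= f a + t * f x.
  exact: (addr_ge0 (ltW fa0) (mulr_ge0 (ltW t0) fx0)).
have sq : (f a + t * f x) ^+ 2 <= f (a + t *: x) ^+ 2.
  by rewrite ler_pXn2r // nnegrE (le_trans ge0).
move=> /(le_trans sq).
rewrite dotDl !dotDr !dotZl !dotZr aa1 (dotC x a) => le.
have : t * (f a * e * 2) <= t * (t * w).
  have -> : t * (f a * e * 2) = 2 * t * f a * f x - 2 * t * f a ^+ 2 * dot a x.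
    by rewrite /e; ring.
  have -> : t * (t * w) = t ^+ 2 * f a ^+ 2 * dot x x by rewrite /w; ring.
  have := sqr_ge0 (t * f x); lra.
rewrite ler_pM2l //; lra.
Qed.

(** At a maximiser [a] of the ratio [M] of [f] to the norm, [f <= M * dot a]
    makes the dual at [a] at least [M^-1], so [M = f a >= M^-1]; and [M <= 1]
    because [f a * f a <= dot a a]. *)
Lemma self_dual_unit_point f : antinorm (quadrant R) f -> self_dual f ->
  exists a, [/\ quadrant R a, dot a a = 1 & f a = 1].
Proof.
move=> an sd; have supf := superlinear_antinorm quadrant_cone an.
have [a [Qa aa1 fa0 fmax]] := maximal_direction an.
exists a; split=> //.
have le1 : f a * f a <= 1 by rewrite -aa1 self_dual_mul_le.
have ge1 : (f a)^-1 <= f a.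
  rewrite -[leRHS]sd //; apply: (dual_on_ge supf (antinorm_pos an)) => x Qx.
  by rewrite ler_pdivrMl //; exact: maximal_direction_support.
have {}ge1 : 1 <= f a * f a by rewrite -ler_pdivrMl // mulr1.
apply/eqP; rewrite -(@eqrXn2 _ 2) ?ltW ?ler01 // expr1n expr2.
by rewrite eq_le le1.
Qed.

(** Gluing the restriction of [f] to one angle gives a self-dual [g >= f];
    since duality reverses order, [f = dual f >= dual g = g]. *)
Lemma self_dual_constructed f : antinorm (quadrant R) f -> self_dual f ->
  exists a i j, construction_data a i j f /\ glued a i j f f.
Proof.
move=> an sd; have supf := superlinear_antinorm quadrant_cone an.
have [a [Qa aa1 fa]] := self_dual_unit_point an sd.
have ij : (0 : 'I_2) != 1 by [].
have coneK := subangle_cone Qa aa1 0.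
have KQ x : subangle a 0 x -> quadrant R x by exact: cone_quadrant.
have supK : superlinear (subangle a 0) f by exact: superlinear_sub supf.
have posK : exists2 x, subangle a 0 x & 0 < f x.
  by exists a; [exact: subangle_ray|rewrite fa].
have data : construction_data a 0 1 f.
  split=> //; first exact/enorm1E.
    apply: (antinorm_superlinear coneK) => //.
    exact: (continuous_subspaceW KQ (antinorm_continuous an)).
  move=> x /KQ Qx; have := self_dual_mul_le an sd Qx Qa.
  by rewrite fa mul1r.
have [g glg0] := glued_exists data.
have [datag glg] := construction_restrict data glg0.
have sdg := glued_self_dual datag glg.
have ang := glued_antinorm datag glg.
have supg := superlinear_antinorm quadrant_cone ang.
have dual_ge p : quadrant R p -> f p <= dual_on (subangle a 0) f p.
  move=> Qp; apply: (dual_on_ge supK posK) => x /KQ Qx.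
  exact: self_dual_mul_le.
have fg x : quadrant R x -> f x <= g x.
  move=> Qx; have [Kx|Kx] := subangle_cover Qa aa1 ij Qx.
    by rewrite glg0.1.
  by rewrite glg0.2 // dual_ge.
exists a, 0, 1; split=> //; split=> // p Kp.
have Qp : quadrant R p by exact: (cone_quadrant (subangle_cone Qa aa1 1)).
apply/eqP; rewrite eq_le dual_ge // -glg0.2 // -[leLHS]sdg // -[leRHS]sd //.
apply: (dual_on_ge supf (antinorm_pos an)) => x Qx.
apply: le_trans (dual_on_mul_le quadrant_cone supg Qp Qx).
rewrite ler_wpM2l ?fg //.
exact: (superlinear_ge0 (dual_on_superlinear quadrant_cone supg
  (antinorm_pos ang))).
Qed.

End Converse.

(* The first conjunct says that the two pieces agree on the common ray, i.e.
   that the construction does yield a function f. *)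
Theorem theorem4 (R : realType) :
  (forall (a : 'rV[R]_2) (i j : 'I_2) (f1 : 'rV[R]_2 -> R),
     construction_data a i j f1 ->
     exists f : 'rV[R]_2 -> R, glued a i j f1 f) /\
  (forall f : 'rV[R]_2 -> R,
     (antinorm (quadrant R) f /\ self_dual f) <->
     (exists (a : 'rV[R]_2) (i j : 'I_2) (f1 : 'rV[R]_2 -> R),
        construction_data a i j f1 /\ glued a i j f1 f)).
Proof.
split=> [a i j f1|f]; first exact: glued_exists.
split=> [[an sd]|[a [i [j [f1 [data1 gl1]]]]]].
  have [a [i [j [data gl]]]] := self_dual_constructed an sd.
  by exists a, i, j, f.
have [data gl] := construction_restrict data1 gl1.
by split; [exact: glued_antinorm data gl|exact: glued_self_dual data gl].
Qed.
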